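(* Let $V$ be a finite set (case $q=1$) or a finite-dimensional $\mathbb{F}_q$-vector space (case $q\ge 2$ a prime power), $n=\operatorname{rk}V$ and $k\in\{0,\ldots,n\}$. Let $f:{V\brack k}\to\mathbb{Z}$ be a non-zero function of degree $t$. Then $$\gcd\left({n\brack k}_q,{n-1\brack k-1}_q,\ldots,{n-t\brack k-t}_q\right)\ \Big|\ \#f .$$
   Context: For $q=1$, ''subspaces'' of $V$ are subsets and $\operatorname{rk}U=\#U$; for $q\ge2$ they are $\mathbb{F}_q$-linear subspaces and $\operatorname{rk}U=\dim U$. $U\le W$ means inclusion. ${V\brack k}$ is the set of all subspaces of $V$ of rank $k$; its cardinality is the Gaussian binomial coefficient ${n\brack k}_q$ (the ordinary binomial coefficient for $q=1$), regarded here as an integer. $\#f=\sum_{K\in{V\brack k}}f(K)$. For a subspace $U$ of $V$, $\boldsymbol{x}_U^{(k)}$ is the characteristic function of $\{K\in{V\brack k}\mid U\le K\}$. For $i\in\{0,\ldots,\min(k,n-k)\}$, $\bar V_i^{(k)}\subseteq\mathbb{R}^{{V\brack k}}$ is the real span of $\{\boldsymbol{x}_I^{(k)}\mid I\in{V\brack i}\}$; these spaces form an increasing chain with $\bar V^{(k)}_{\min(k,n-k)}=\mathbb{R}^{{V\brack k}}$. The degree of a non-zero $f:{V\brack k}\to\mathbb{R}$ is the smallest $t\in\{0,\ldots,\min(k,n-k)\}$ with $f\in\bar V_t^{(k)}$. *)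

(* Defs.v *)
From HB Require Import structures.
From mathcomp Require Import all_boot all_order all_algebra.
From mathcomp Require Import reals.

Set Implicit Arguments.
Unset Strict Implicit.
Unset Printing Implicit Defensive.

Import GRing.Theory VectorInternalTheory.

Local Open Scope ring_scope.

(* MathComp only provides a choiceType structure on {vspace W}. *)
HB.instance Definition _ (F : finFieldType) (W : vectType F) :=
  Choice_isCountable.Build {vspace W} (pcan_pickleK (can_pcan (@vs2mxK F W))).
HB.instance Definition _ (F : finFieldType) (W : vectType F) :=
  isFinite.Build {vspace W} (pcan_enumP (can_pcan (@vs2mxK F W))).

(* The ambient object V: a finite set (q = 1) or a finite-dimensional vector
   space over a finite field with q elements. *)
Inductive ambient : Type :=
| AmbSet (T : finType)
| AmbVect (F : finFieldType) (W : vectType F).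

Definition order_of (V : ambient) : nat :=
  match V with
  | AmbSet _ => 1%N
  | AmbVect F _ => #|F|
  end.

Definition subspace (V : ambient) : finType :=
  match V with
  | AmbSet T => {set T}
  | AmbVect F W => {vspace W}
  end.

Definition rk (V : ambient) : subspace V -> nat :=
  match V return subspace V -> nat with
  | AmbSet T => fun U : {set T} => #|U|
  | AmbVect F W => fun U : {vspace W} => \dim U
  end.

Definition incl (V : ambient) : rel (subspace V) :=
  match V return rel (subspace V) with
  | AmbSet T => fun U U' : {set T} => U \subset U'
  | AmbVect F W => fun U U' : {vspace W} => (U <= U')%VS
  end.

Definition whole (V : ambient) : subspace V :=
  match V return subspace V with
  | AmbSet T => [set: T]
  | AmbVect F W => fullv : {vspace W}
  end.

Definition ambient_rk (V : ambient) : nat := rk (whole V).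

Definition Gr (V : ambient) (k : nat) : finType :=
  {K : subspace V | rk K == k}.

(* For q >= 2 the division is exact; the result is 0 if n < k, because the
   numerator then has the factor q ^ 0 - 1. *)
Definition gauss_binom (q n k : nat) : nat :=
  if q == 1%N then 'C(n, k)
  else ((\prod_(i < k) (q ^ (n - i) - 1)) %/ (\prod_(i < k) (q ^ i.+1 - 1)))%N.

Definition char_fun (R : realType) (V : ambient) (k : nat) (U : subspace V) :
    {ffun Gr V k -> R^o} :=
  [ffun K => (incl U (val K))%:R].

Definition Vbar (R : realType) (V : ambient) (k i : nat) :
    {vspace {ffun Gr V k -> R^o}} :=
  <<[seq char_fun R k (val U) | U : Gr V i]>>%VS.

Definition has_degree (R : realType) (V : ambient) (k : nat)
    (f : {ffun Gr V k -> R^o}) (t : nat) : Prop :=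
  let m := minn k (ambient_rk V - k) in
  [/\ (t <= m)%N, f \in Vbar R V k t
    & forall s : nat, (s <= m)%N -> f \in Vbar R V k s -> (t <= s)%N].

Definition int_to_real_fun (R : realType) (V : ambient) (k : nat)
    (f : {ffun Gr V k -> int}) : {ffun Gr V k -> R^o} :=
  [ffun K => (f K)%:~R].

Definition fun_size (V : ambient) (k : nat) (f : {ffun Gr V k -> int}) : int :=
  \sum_(K : Gr V k) f K.

(* Main.v *)
(* By duality it suffices to find, after inverting q, an integral signed design:
   with d the gcd in question, a function g on the k-subspaces such that
   d * (sum of g over the K >= I) is q^N times the number of K >= I, for all I of
   rank at most t.  Pairing g with f, which is a real combination of the x_I with
   rk I = t, gives d * <f, g> = q^N * #f, and d is coprime to q because Gaussian
   binomials are.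

   Any family a_I (rk I <= t) satisfying the necessary relations
   [k - rk S] a_S = sum of a_X over the covers X of S is, up to a power of q, of
   the form a_I = sum of g(K) over K >= I, provided t <= k and k + t <= n.  The
   proof is by induction on n: choose a hyperplane H and first solve for I not
   below H.  There, a is split into a part depending on I /\ H only and, for each
   hyperplane M <> H, a part supported on the I below M and depending on I /\ H
   only; these reduce to H and to M /\ H.  The remaining family lives on H. *)
Require Import Defs.
From mathcomp Require Import all_boot all_order all_algebra all_field.
From mathcomp Require Import reals.
From mathcomp Require Import zify ring.

Set Implicit Arguments.
Unset Strict Implicit.
Unset Printing Implicit Defensive.

Import Order.TTheory GRing.Theory Num.Theory.

Local Open Scope nat_scope.

(** * q-numbers *)

Definition qnum (q r : nat) : nat := \sum_(i < r) q ^ i.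

Lemma qnum0 q : qnum q 0 = 0.
Proof. by rewrite /qnum big_ord0. Qed.

Lemma qnumSr q r : qnum q r.+1 = qnum q r + q ^ r.
Proof. by rewrite /qnum big_ord_recr. Qed.

Lemma qnumS q r : qnum q r.+1 = 1 + q * qnum q r.
Proof.
rewrite /qnum big_ord_recl expn0 big_distrr /=; congr (_ + _).
by apply: eq_bigr => i _; rewrite expnS.
Qed.

Lemma qnum1 q : qnum q 1 = 1.
Proof. by rewrite qnumSr qnum0. Qed.

Lemma qnum_gt0 q r : 0 < r -> 0 < qnum q r.
Proof. by case: r => // r _; rewrite qnumS. Qed.

Lemma qnum_geom q r : qnum q r * (q - 1) = q ^ r - 1.
Proof. by rewrite mulnC !subn1 predn_exp. Qed.

Lemma coprime_qnum q r : 0 < r -> coprime q (qnum q r).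
Proof. by case: r => // r _; rewrite qnumS addnC mulnC /coprime gcdnMDl gcdn1. Qed.

(** Vectors are counted in [finvect_type W], the copy of [W] that carries a finite type
    structure. *)
Lemma card_vect_set (F : finFieldType) (W : vectType F) (Y : {vspace W}) :
  #|[set v : finvect_type W | (v : W) \in Y]| = #|F| ^ \dim Y.
Proof.
case: W Y => T cT Y.
by rewrite -(@card_vspace F (finvect_type (Vector.Pack cT)) cT Y) cardsE; apply: eq_card.
Qed.

(** * The modular lattice of subspaces, uniformly for sets and vector spaces *)

Definition meet (V : ambient) : subspace V -> subspace V -> subspace V :=
  match V return subspace V -> subspace V -> subspace V with
  | AmbSet T => fun U U' : {set T} => U :&: U'
  | AmbVect F W => fun U U' : {vspace W} => (U :&: U')%VS
  end.

Definition join (V : ambient) : subspace V -> subspace V -> subspace V :=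
  match V return subspace V -> subspace V -> subspace V with
  | AmbSet T => fun U U' : {set T} => U :|: U'
  | AmbVect F W => fun U U' : {vspace W} => (U + U')%VS
  end.

Definition bottom (V : ambient) : subspace V :=
  match V return subspace V with
  | AmbSet T => set0
  | AmbVect F W => 0%VS : {vspace W}
  end.

Definition between (V : ambient) (S A : subspace V) (k : nat) : pred (subspace V) :=
  [pred K | [&& incl S K, incl K A & rk K == k]].

Section Lattice.
Variable V : ambient.
Implicit Types A B I K S X Y Z : subspace V.

Lemma incl_refl X : incl X X.
Proof. by case: V X => [T|F W] X /=; [exact: subxx|exact: subvv]. Qed.

Lemma incl_trans Y X Z : incl X Y -> incl Y Z -> incl X Z.
Proof. by case: V X Y Z => [T|F W] X Y Z /=; [exact: subset_trans|exact: subv_trans]. Qed.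

Lemma bottom_incl X : incl (bottom V) X.
Proof. by case: V X => [T|F W] X /=; [exact: sub0set|exact: sub0v]. Qed.

Lemma incl_whole X : incl X (whole V).
Proof. by case: V X => [T|F W] X /=; [exact: subsetT|exact: subvf]. Qed.

Lemma rk_bottom : rk (bottom V) = 0.
Proof. by case: V => [T|F W] /=; [exact: cards0|exact: dimv0]. Qed.

Lemma incl_meet Z X Y : incl Z (meet X Y) = incl Z X && incl Z Y.
Proof. by case: V X Y Z => [T|F W] X Y Z /=; [exact: subsetI|exact: subv_cap]. Qed.

Lemma incl_join X Y Z : incl (join X Y) Z = incl X Z && incl Y Z.
Proof. by case: V X Y Z => [T|F W] X Y Z /=; [exact: subUset|exact: subv_add]. Qed.

Lemma rk_modular X Y : rk (join X Y) + rk (meet X Y) = rk X + rk Y.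
Proof. by case: V X Y => [T|F W] X Y /=; [exact: cardsUI|exact: dimv_sum_cap]. Qed.

Lemma rk_incl X Y : incl X Y -> rk X <= rk Y.
Proof. by case: V X Y => [T|F W] X Y /=; [exact: subset_leq_card|exact: dimvS]. Qed.

Lemma incl_rk_eq X Y : incl X Y -> rk Y <= rk X -> X = Y.
Proof.
case: V X Y => [T|F W] X Y /= sXY le.
  by apply/eqP; rewrite eqEcard sXY.
by apply/eqP; rewrite eqEdim sXY.
Qed.

Lemma order_of_gt0 : 0 < order_of V.
Proof. by case: V => [T|F W] //=; apply/card_gt0P; exists 0%R. Qed.

(** For sets, the covers are the [x |: S] with [x] in [A :\: S]. For vector spaces, the vectors of
    [A] outside [S] are sorted by the cover [S + <[v]>] that they generate; each cover receives
    [q ^ (rk S).+1 - q ^ rk S] of them. *)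
Lemma card_covers S A : incl S A ->
  #|between S A (rk S).+1| = qnum (order_of V) (rk A - rk S).
Proof.
case: V S A => [T|F W] /= S A sSA; rewrite /between /=.
  rewrite /qnum (eq_bigr (fun=> 1)) => [|i _]; last by rewrite exp1n.
  rewrite sum1_card card_ord -cardsDS //.
  rewrite -(card_in_imset (D := A :\: S) (f := fun x => x |: S)); last first.
    move=> x y /setDP [_ xS] _ /setP/(_ x).
    by rewrite !inE eqxx (negPf xS) /= orbF => /esym/eqP.
  apply: eq_card => X; rewrite inE; apply/idP/imsetP.
    case/and3P=> sSX sXA /eqP rX.
    have /cards1P[x Dx]: #|X :\: S| == 1 by rewrite cardsDS // rX subSn // subnn.
    have xX : x \in X :\: S by rewrite Dx set11.
    exists x; first by move: xX; rewrite !inE => /andP[-> /(subsetP sXA)].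
    by rewrite -[LHS](setID X S) (setIidPr sSX) Dx setUC.
  move=> [x]; rewrite !inE => /andP[xS xA] ->; rewrite subsetUr subUset sub1set xA sSA /=.
  by rewrite cardsU1 xS add1n.
pose fW := finvect_type W.
have q1 : 1 < #|F| by apply: finRing_gt1.
pose P := [pred X : {vspace W} | [&& (S <= X)%VS, (X <= A)%VS & \dim X == (\dim S).+1]].
pose D (X : {vspace W}) := [set v : fW | (v \in X) && (v \notin S)].
have cardD (X : {vspace W}) : (S <= X)%VS -> #|D X| = #|F| ^ \dim X - #|F| ^ \dim S.
  move=> sSX.
  have -> : #|D X| = #|[set v : fW | v \in X] :\: [set v : fW | v \in S]|.
    by apply: eq_card => v; rewrite !inE andbC.
  rewrite cardsDS; last by apply/subsetP=> v; rewrite !inE; apply: (subvP sSX).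
  by rewrite !card_vect_set.
have cover_line (v : W) : v \notin S -> \dim (S + <[v]>)%VS = (\dim S).+1.
  move=> vS; rewrite dimv_disjoint_sum.
    by rewrite dim_vline; case: eqP vS => [->|_ _]; rewrite ?mem0v ?addn1.
  apply/eqP; rewrite -subv0; apply/subvP=> u; rewrite memv_cap => /andP[uS /vlineP[c Du]].
  case: (eqVneq c 0%R) Du => [->|c0] Du; first by rewrite Du scale0r mem0v.
  by case/negP: vS; rewrite -[v](scalerK c0) -Du memvZ.
have DA : #|D A| = \sum_(X | P X) #|D X|.
  rewrite -sum1_card (partition_big (fun v : fW => (S + <[v : W]>)%VS) P) /=.
    apply: eq_bigr => X /and3P[sSX sXA /eqP rX]; rewrite -sum1_card; apply: eq_bigl => v.
    rewrite !inE; apply/idP/idP.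
      case/andP=> /andP[vA vS] /eqP <-; rewrite vS andbT.
      by apply: (subvP (addvSr _ _)); apply: memv_line.
    case/andP=> vX vS; rewrite (subvP sXA _ vX) vS /= eqEdim cover_line // rX leqnn andbT.
    by rewrite subv_add sSX -memvE.
  move=> v; rewrite !inE => /andP[vA vS]; rewrite addvSl subv_add sSA -memvE vA.
  by rewrite cover_line /=.
have e : #|P| * (#|F| ^ (\dim S).+1 - #|F| ^ \dim S) = #|F| ^ \dim A - #|F| ^ \dim S.
  rewrite -cardD // DA -sum_nat_const; apply: eq_bigr => X /and3P[sSX _ /eqP rX].
  by rewrite cardD // rX.
have dSA := dimvS sSA.
have e2 : #|F| ^ \dim A - #|F| ^ \dim S
  = qnum #|F| (\dim A - \dim S) * (#|F| ^ (\dim S).+1 - #|F| ^ \dim S).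
  rewrite expnS -{1 3}[#|F| ^ \dim S]mul1n -mulnBl mulnA qnum_geom mulnBl -expnD subnK //.
apply/eqP; move: e; rewrite e2 => /eqP; rewrite eqn_pmul2r //.
by rewrite subn_gt0 ltn_exp2l.
Qed.
End Lattice.

(** * Counting subspaces in an interval *)

Section LatticeTheory.
Variable V : ambient.
Implicit Types A H I K L M S X Y Z T D : subspace V.
Notation q := (order_of V).

Lemma incl_anti X Y : incl X Y -> incl Y X -> X = Y.
Proof. by move=> XY /rk_incl; apply: incl_rk_eq. Qed.

Lemma meet_incll X Y : incl (meet X Y) X.
Proof. by have := incl_refl (meet X Y); rewrite incl_meet => /andP[]. Qed.

Lemma meet_inclr X Y : incl (meet X Y) Y.
Proof. by have := incl_refl (meet X Y); rewrite incl_meet => /andP[]. Qed.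

Lemma incl_joinl X Y : incl X (join X Y).
Proof. by have := incl_refl (join X Y); rewrite incl_join => /andP[]. Qed.

Lemma incl_joinr X Y : incl Y (join X Y).
Proof. by have := incl_refl (join X Y); rewrite incl_join => /andP[]. Qed.

Lemma meet_incl2 X Y Z : incl X Y -> incl (meet X Z) (meet Y Z).
Proof.
by move=> XY; rewrite incl_meet meet_inclr (incl_trans (meet_incll X Z)).
Qed.

Lemma rk_bottomP X : rk X = 0 -> X = bottom V.
Proof.
by move=> r0; apply/esym/incl_rk_eq; [exact: bottom_incl|rewrite r0].
Qed.

(** Induction on [k], counting in two ways the pairs of a cover [X] of [S] and a [K] above [X]. The
    product form avoids division. *)
Lemma card_between S A k : incl S A ->
  #|between S A (rk S + k)| * \prod_(i < k) qnum q i.+1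
  = \prod_(i < k) qnum q (rk A - rk S - i).
Proof.
elim: k S => [|k IHk] S SA.
  rewrite !big_ord0 muln1 addn0 (@eq_card1 _ S) // => K; rewrite !inE.
  apply/and3P/eqP => [[SK _ /eqP rK]|->]; last by rewrite incl_refl SA.
  by apply/esym/incl_rk_eq; rewrite ?rK.
rewrite big_ord_recr [in RHS]big_ord_recl /= subn0 mulnCA.
have -> : #|between S A (rk S + k.+1)| * qnum q k.+1
  = \sum_(X in between S A (rk S).+1) #|between X A (rk X + k)|.
  rewrite -sum_nat_const.
  transitivity (\sum_(K in between S A (rk S + k.+1)) #|between S K (rk S).+1|).
    apply: eq_bigr => K /and3P[SK _ /eqP rK].
    by rewrite card_covers // rK addKn.
  under eq_bigr do rewrite -sum1_card; under [RHS]eq_bigr do rewrite -sum1_card.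
  rewrite (exchange_big_dep [in between S A (rk S).+1]) /=; last first.
    by move=> K X /and3P[_ KA _] /and3P[SX XK rX]; rewrite !inE SX rX (incl_trans XK).
  apply: eq_bigr => X /and3P[SX XA /eqP rX]; apply: eq_bigl => K.
  rewrite !inE SX rX eqxx addnS addSn andbT /=.
  case XK: (incl X K); rewrite ?andbF ?andbT //=.
  by rewrite (incl_trans SX XK).
rewrite big_distrr /= -(@card_covers _ S A) // -sum_nat_const.
apply: eq_bigr => X /and3P[SX XA /eqP rX]; rewrite mulnC IHk // rX.
by apply: eq_bigr => i _; congr qnum; rewrite /bump; lia.
Qed.

Lemma prod_qnum_gt0 k : 0 < \prod_(i < k) qnum q i.+1.
Proof. by apply: prodn_gt0 => i; apply: qnum_gt0. Qed.

(** If [rk S < rk A], this is [card_between] one rank below [A], where all factors but the largest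
    cancel. *)
Lemma card_coatoms S A : incl S A ->
  #|[pred M | [&& incl S M, incl M A & (rk M).+1 == rk A]]| = qnum q (rk A - rk S).
Proof.
move=> SA; have := rk_incl SA; rewrite leq_eqVlt => /orP[/eqP e|lt].
  rewrite e subnn qnum0; apply: eq_card0 => M; rewrite !inE.
  by apply/and3P => -[/rk_incl]; rewrite e => ? _ /eqP; lia.
have [r Dr] : exists r, rk A - rk S = r.+1 by exists (rk A - rk S).-1; lia.
have := card_between r SA; rewrite Dr => e; apply/eqP.
rewrite -(eqn_pmul2r (prod_qnum_gt0 r)); apply/eqP.
transitivity (\prod_(i < r) qnum q (r.+1 - i)).
  rewrite -e; congr (_ * _); apply: eq_card => M; rewrite !inE.
  by congr [&& _, _ & _]; lia.
have <- : \prod_(i < r.+1) qnum q i.+1 = qnum q r.+1 * \prod_(i < r) qnum q i.+1.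
  by rewrite big_ord_recr mulnC.
rewrite [RHS](reindex_inj rev_ord_inj) big_ord_recr /= subnn qnum1 muln1.
by apply: eq_bigr => i _; congr qnum; have := ltn_ord i; lia.
Qed.

Lemma ex_between S A k : incl S A -> rk S <= k <= rk A ->
  exists K, between S A k K.
Proof.
move=> SA /andP[Sk kA].
suff /card_gt0P[K] : 0 < #|between S A k| by rewrite inE; exists K.
have := card_between (k - rk S) SA; rewrite subnKC // => e.
have : 0 < #|between S A k| * \prod_(i < k - rk S) qnum q i.+1.
  rewrite e; apply: prodn_gt0 => i; apply: qnum_gt0.
  by have := ltn_ord i; lia.
by rewrite muln_gt0 => /andP[].
Qed.

(** * Intersection with a hyperplane *)

Definition hyperplane H A := incl H A /\ rk A = (rk H).+1.

Lemma rk_meet_hyperplane H A I :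
  hyperplane H A -> incl I A -> ~~ incl I H -> rk I = (rk (meet I H)).+1.
Proof.
move=> [HA rA] IA nIH; have := rk_modular I H.
suff -> : rk (join I H) = rk A by rewrite rA; lia.
apply/eqP; rewrite eqn_leq rk_incl ?incl_join ?IA //= leqNgt rA ltnS.
apply: contra nIH => le.
by rewrite (incl_rk_eq (incl_joinr I H) le) incl_joinl.
Qed.

Lemma hyperplane_meet H A I :
  hyperplane H A -> incl I A -> ~~ incl I H -> hyperplane (meet I H) I.
Proof.
move=> hH IA nIH; split; first exact: meet_incll.
exact: rk_meet_hyperplane hH IA nIH.
Qed.

Lemma join_meet_hyperplane H A I D : hyperplane H A -> incl I A -> ~~ incl I H ->
  incl (meet I H) D -> incl D H ->
  [/\ rk (join D I) = (rk D).+1, ~~ incl (join D I) H & meet (join D I) H = D].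
Proof.
move=> hH IA nIH TD DH; have [HA rA] := hH.
have nJH : ~~ incl (join D I) H by rewrite incl_join negb_and nIH orbT.
have rI := rk_meet_hyperplane hH IA nIH.
have rT : rk (meet D I) = rk (meet I H).
  apply/eqP; rewrite eqn_leq !rk_incl // incl_meet.
    by rewrite TD meet_incll.
  by rewrite meet_inclr (incl_trans (meet_incll D I)).
have rJ : rk (join D I) = (rk D).+1 by have := rk_modular D I; rewrite rT rI; lia.
split=> //; apply/esym/incl_rk_eq; first by rewrite incl_meet incl_joinl.
have JA : incl (join D I) A by rewrite incl_join IA (incl_trans DH).
by have := rk_meet_hyperplane hH JA nJH; rewrite rJ => -[->].
Qed.

Lemma join_meetK H A I K : hyperplane H A -> incl I K -> incl K A -> ~~ incl I H ->
  join (meet K H) I = K.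
Proof.
move=> hH IK KA nIH.
have IA := incl_trans IK KA.
have nKH : ~~ incl K H by apply: contra nIH; apply: incl_trans.
apply: incl_rk_eq; first by rewrite incl_join meet_incll.
have [-> _ _] := join_meet_hyperplane hH IA nIH (meet_incl2 H IK) (meet_inclr K H).
by rewrite (rk_meet_hyperplane hH KA nKH).
Qed.

(** For [I] off [H], the maps [K |-> meet K H] and [D |-> join D I] are inverse bijections between
    the two index sets. *)
Lemma big_between_meet (R : Type) (idx : R) (op : Monoid.com_law idx)
    H A I k (F : subspace V -> R) :
  hyperplane H A -> incl I A -> ~~ incl I H ->
  \big[op/idx]_(K in between I A k.+1) F (meet K H)
  = \big[op/idx]_(D in between (meet I H) H k) F D.
Proof.
move=> hH IA nIH.
rewrite [RHS](reindex_onto (fun K => meet K H) (fun D => join D I)) /=; last first.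
  by move=> D /and3P[TD DH _]; have [_ _ ->] := join_meet_hyperplane hH IA nIH TD DH.
apply: eq_bigl => K; rewrite !inE; apply/and3P/andP.
  move=> [IK KA /eqP rK]; rewrite meet_inclr meet_incl2 //=.
  have nKH : ~~ incl K H by apply: contra nIH; apply: incl_trans.
  have := rk_meet_hyperplane hH KA nKH; rewrite rK => -[<-].
  by rewrite eqxx (join_meetK hH IK KA nIH) eqxx.
move=> [/and3P[TD DH /eqP rD] /eqP Dk].
have [rJ _ _] := join_meet_hyperplane hH IA nIH TD DH.
rewrite -Dk incl_joinr rJ rD; split=> //.
by rewrite incl_join IA andbT (incl_trans DH) //; case: hH.
Qed.

(** The covers of [T] in [A] minus those in [H]: the difference of two consecutive q-numbers is a
    power of [q]. *)
Lemma card_covers_off T H A : hyperplane H A -> incl T H ->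
  #|[pred S | between T A (rk T).+1 S && ~~ incl S H]| = q ^ (rk H - rk T).
Proof.
move=> [HA rA] TH; have TA := incl_trans TH HA.
apply/eqP; rewrite -(eqn_add2l (qnum q (rk H - rk T))) -qnumSr -subSn ?rk_incl //.
rewrite -rA -!card_covers // -[in eqbRHS](cardID [pred S | incl S H]); apply/eqP.
congr (_ + _).
  apply: eq_card => S; rewrite !inE.
  by case SH: (incl S H); rewrite ?andbF //= (incl_trans SH HA) andbT.
by apply: eq_card => S; rewrite !inE andbC.
Qed.

End LatticeTheory.

Local Open Scope ring_scope.

Lemma sum_indicator (I : finType) (P b : pred I) :
  \sum_(i | P i) (b i)%:R = \sum_(i | P i && b i) 1 :> int.
Proof. by rewrite big_mkcondr; apply: eq_bigr => i _; case: (b i). Qed.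

(** * Integral signed designs and their consistency relations *)

Section Designs.
Variable V : ambient.
Implicit Types A H I K L M S X Y Z T D : subspace V.
Implicit Types a g w : subspace V -> int.
Notation q := (order_of V).

(** The pairing of [g] with the characteristic function of [I]. The subspace [A] acts as ambient
    space, so that the induction can descend to hyperplanes inside the same [V]. *)
Definition shadow A (k : nat) g I : int := \sum_(K in between I A k) g K.

Definition consistent A (k t : nat) a := forall S, incl S A -> (rk S < t)%N ->
  (qnum q (k - rk S))%:R * a S = shadow A (rk S).+1 a S.

(** After exchanging the sums, each [K] is counted once for every cover of [S] below it. *)
Lemma shadow_shadow A k g S : incl S A ->
  shadow A (rk S).+1 (shadow A k g) S = (qnum q (k - rk S))%:R * shadow A k g S.
Proof.
move=> SA; rewrite /shadow mulr_sumr.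
rewrite (exchange_big_dep [in between S A k]) /=; last first.
  by move=> X K /and3P[SX XA _] /and3P[XK KA rK]; rewrite !inE (incl_trans SX) ?KA.
apply: eq_bigr => K /and3P[SK KA /eqP rK].
rewrite -rK -(card_covers SK) mulr_natl -sumr_const; apply: eq_bigl => X.
rewrite !inE KA eqxx andbT /=; case XK: (incl X K); last by rewrite !andbF.
by rewrite (incl_trans XK KA) !andbT.
Qed.

Lemma consistent_shadow A k t g : consistent A k t (shadow A k g).
Proof. by move=> S SA _; rewrite shadow_shadow. Qed.

Lemma shadow_rk A k g I : incl I A -> rk I = k -> shadow A k g I = g I.
Proof.
move=> IA rI; rewrite /shadow (big_pred1 I) // => K; rewrite !inE.
apply/and3P/eqP => [[IK _ /eqP rK]|->]; last by rewrite incl_refl IA rI.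
by apply/esym/incl_rk_eq; rewrite ?rK ?rI.
Qed.

(** Descending induction on [rk I]: the relation at [I] determines [a I] from the values one rank
    higher, since its coefficient is non-zero. *)
Lemma shadow_consistent A k a I :
  consistent A k k a -> incl I A -> (rk I <= k)%N -> shadow A k a I = a I.
Proof.
move=> ca; move: {2}(k - rk I)%N (erefl (k - rk I)%N) => d.
elim: d I => [|d IHd] I dI IA rI; first by apply: shadow_rk => //; lia.
have lt : (rk I < k)%N by lia.
have qn0 : (qnum q (k - rk I))%:R != 0 :> int.
  by rewrite pnatr_eq0 -lt0n qnum_gt0 // subn_gt0.
apply: (mulfI qn0); rewrite -shadow_shadow // ca //.
by apply: eq_bigr => K /and3P[IK KA /eqP rK]; apply: IHd => //; lia.
Qed.

Lemma consistentD A k t a1 a2 (c1 c2 : int) :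
  consistent A k t a1 -> consistent A k t a2 ->
  consistent A k t (fun I => c1 * a1 I + c2 * a2 I).
Proof.
move=> h1 h2 S SA rS; rewrite /shadow big_split /= -!mulr_sumr.
by rewrite -[\sum_(_ in _) a1 _]h1 // -[\sum_(_ in _) a2 _]h2 //; ring.
Qed.

Lemma shadowD A k g1 g2 (c1 c2 : int) I :
  shadow A k (fun K => c1 * g1 K + c2 * g2 K) I
  = c1 * shadow A k g1 I + c2 * shadow A k g2 I.
Proof. by rewrite /shadow big_split /= -!mulr_sumr. Qed.

(** The exponent [N] is fixed before [A] and [a], so solutions for different hyperplanes share one
    factor and can be added. *)
Definition solvable N n k t := forall A a, rk A = n -> consistent A k t a ->
  exists g, forall I, incl I A -> (rk I <= t)%N ->
    shadow A k g I = (q ^ N)%:R * a I.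

(** Only the value at [bottom V] is prescribed, so all the weight can sit on a single [K0]. *)
Lemma solvable0 n k : (k <= n)%N -> solvable 0 n k 0.
Proof.
move=> kn A a rA _.
have [] := @ex_between V (bottom V) A k (bottom_incl A); first by rewrite rk_bottom rA.
move=> K0 /and3P[_ K0A rK0]; exists (fun K => (K == K0)%:R * a (bottom V)) => I IA.
rewrite leqn0 => /eqP/rk_bottomP ->; rewrite expn0 mul1r /shadow.
rewrite (bigD1 K0) /= ?inE ?bottom_incl ?K0A //= eqxx mul1r big1 ?addr0 //.
by move=> K /andP[_ /negPf->]; rewrite mul0r.
Qed.

Lemma solvable_diag n k : solvable 0 n k k.
Proof.
by move=> A a rA ca; exists a => I IA rI; rewrite mul1r; apply: shadow_consistent.
Qed.

(** * Splitting a consistent family off a hyperplane *)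

Section Hyperplane.
Variables H A : subspace V.
Hypothesis hH : hyperplane H A.

Let HA : incl H A. Proof. by case: hH. Qed.

(* The factor [q ^ rk T] makes up for the [q] different [S <= X] with [S /\ H = T]
   when [X /\ H] covers [T]; with it the consistency relations are preserved. *)
Definition off_sum w a T : int := (q ^ rk T)%:R *
  \sum_(I | between T A (rk T).+1 I && ~~ incl I H) a I * w I.

Lemma off_cover_meet T I : incl T H ->
  between T A (rk T).+1 I -> ~~ incl I H -> meet I H = T.
Proof.
move=> TH /and3P[TI IA /eqP rI] nIH; apply/esym/incl_rk_eq.
  by rewrite incl_meet TI.
by have := rk_meet_hyperplane hH IA nIH; rewrite rI => -[->].
Qed.

Lemma consistent_off_sum k t L w a : consistent A k t a -> incl L H ->
  (forall T X, incl T L -> between T A (rk T).+2 X -> ~~ incl X H ->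
     \sum_(S | between T X (rk T).+1 S && ~~ incl S H) w S
     = q%:R * w X * (incl (meet X H) L)%:R) ->
  consistent L k.-1 t.-1 (off_sum w a).
Proof.
move=> ca LH hw T TL rT; rewrite /off_sum /shadow.
pose P X := between T A (rk T).+2 X && ~~ incl X H.
have TH := incl_trans TL LH.
(* Both sides equal this sum: the left one by consistency of [a] and the hypothesis on [w], the
   right one because each [X] with [meet X H] below [L] occurs for exactly one cover of [T], namely
   [meet X H]. *)
transitivity ((q ^ (rk T))%:R * \sum_(X | P X) a X * (q%:R * w X * (incl (meet X H) L)%:R)).
  rewrite mulrCA; congr (_ * _); rewrite mulr_sumr.
  under [RHS]eq_bigr => X /andP[bX nX] do rewrite -(hw _ _ TL bX nX) mulr_sumr.
  rewrite (exchange_big_dep (fun S => between T A (rk T).+1 S && ~~ incl S H)) /=; last first.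
    move=> X S /andP[/and3P[TX XA rX] nX] /andP[/and3P[TS SX rS] nS].
    by rewrite /between /= TS (incl_trans SX XA) rS nS.
  apply: eq_bigr => S /andP[/and3P[TS SA /eqP rS] nS].
  have -> : (k.-1 - rk T = k - rk S)%N by rewrite rS; lia.
  rewrite mulrA ca //; last by rewrite rS; lia.
  rewrite /shadow mulr_suml; apply: eq_big => [X|X _]; last by rewrite mulrC.
  rewrite /P /between /= !inE rS TS nS eqxx /=.
  case SX: (incl S X); last by rewrite ?andbF.
  have -> : ~~ incl X H by apply: contra nS; apply: incl_trans.
  by rewrite (incl_trans TS SX) /= !andbT.
under [RHS]eq_bigr => T' /and3P[_ _ /eqP rT'] do rewrite rT' mulr_sumr.
rewrite (exchange_big_dep P) /=; last first.
  move=> T' X /and3P[TT' T'L rT'] /andP[/and3P[T'X XA rX] nX].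
  by rewrite /P /between /= XA rX nX (incl_trans TT').
rewrite mulr_sumr; apply: eq_bigr => X /andP[/and3P[TX XA /eqP rX] nX].
have rXH : rk (meet X H) = (rk T).+1.
  by have := rk_meet_hyperplane hH XA nX; rewrite rX => -[].
case XL: (incl (meet X H) L); last first.
  rewrite !mulr0 big_pred0 // => T'; apply/negP => /andP[/and3P[TT' T'L /eqP rT']].
  rewrite nX andbT => /and3P[T'X _ _]; move/negP: XL; apply.
  have -> // : meet X H = T'.
  apply/esym/incl_rk_eq; first by rewrite incl_meet T'X (incl_trans T'L).
  by rewrite rXH rT'.
rewrite (big_pred1 (meet X H)).
  by rewrite expnS natrM mulr1; move: (_%:R) (q%:R) => x y; ring.
move=> T' /=; apply/idP/eqP.
  move=> /andP[/and3P[TT' T'L /eqP rT'] /andP[/and3P[T'X _ _] _]].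
  apply/incl_rk_eq; first by rewrite incl_meet T'X (incl_trans T'L).
  by rewrite rXH rT'.
by move=> ->; rewrite !inE /between /= XL rXH rX XA nX meet_incll incl_meet TX TH !eqxx.
Qed.

(** This is [card_covers_off] inside [X], whose hyperplane [meet X H] has rank one more than [T]. *)
Lemma sum_off_const T X : incl T H -> between T A (rk T).+2 X -> ~~ incl X H ->
  \sum_(S | between T X (rk T).+1 S && ~~ incl S H) 1 = q%:R :> int.
Proof.
move=> TH /and3P[TX XA /eqP rX] nX.
have hX := hyperplane_meet hH XA nX; have := hX => -[_]; rewrite rX => -[rXH].
have TXH : incl T (meet X H) by rewrite incl_meet TX.
have := card_covers_off hX TXH; rewrite -rXH subSn // subnn expn1 => <-.
rewrite sumr_const; congr (_%:R); apply: eq_card => S.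
rewrite !inE incl_meet [LHS]unfold_in /between /=.
by case SX: (incl S X); rewrite /= ?andbF.
Qed.

Lemma consistent_off_sum1 k t a :
  consistent A k t a -> consistent H k.-1 t.-1 (off_sum (fun=> 1) a).
Proof.
move=> ca; apply: consistent_off_sum ca (incl_refl H) _ => T X TH bX nX.
by rewrite sum_off_const // meet_inclr !mulr1.
Qed.

(* [off_sum (hyper_weight M) a T] is a multiple of the difference between the average
   of [a] over the [I <= M] with [I /\ H = T] and its average over all such [I]. *)
Definition hyper_weight M I : int := q%:R * (incl I M)%:R - 1.

(** Of the [q] subspaces [S] in the sum, all lie below [M] if [X] does. Otherwise none does if
    [meet X H] lies below [M], since then [meet X M = meet X H]; in the remaining case only
    [meet X M] does, and the sum is [q - q]. *)
Lemma sum_off_hyper_weight M T X : hyperplane M A -> M != H ->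
  incl T (meet M H) -> between T A (rk T).+2 X -> ~~ incl X H ->
  \sum_(S | between T X (rk T).+1 S && ~~ incl S H) hyper_weight M S
  = q%:R * hyper_weight M X * (incl (meet X H) (meet M H))%:R.
Proof.
move=> hM neMH; rewrite incl_meet => /andP[TM TH] bX nX.
have /and3P[TX XA /eqP rX] := bX.
have rXH : rk (meet X H) = (rk T).+1.
  by have := rk_meet_hyperplane hH XA nX; rewrite rX => -[].
rewrite /hyper_weight sumrB sum_off_const // -mulr_sumr incl_meet meet_inclr andbT.
rewrite sum_indicator.
case XM: (incl X M).
  rewrite (incl_trans (meet_incll X H) XM) /= mulr1.
  rewrite (eq_bigl (fun S => between T X (rk T).+1 S && ~~ incl S H)); last first.
    move=> S /=; apply: andb_idr => /andP[/and3P[_ SX _] _].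
    exact: incl_trans SX XM.
  by rewrite sum_off_const //; ring.
have rXM : rk (meet X M) = (rk T).+1.
  by have := rk_meet_hyperplane hM XA (negbT XM); rewrite rX => -[].
case XHM: (incl (meet X H) M).
  have eXM : meet X H = meet X M.
    by apply: incl_rk_eq; rewrite ?rXM ?rXH // incl_meet meet_incll.
  rewrite big_pred0; first by rewrite /=; ring.
  move=> S /=; apply/negP => /andP[/andP[/and3P[_ SX _]] nS SM]; case/negP: nS.
  by apply: incl_trans (meet_inclr X H); rewrite eXM incl_meet SX.
rewrite (big_pred1 (meet X M)); first by rewrite /=; ring.
move=> S /=; apply/idP/eqP.
  move=> /andP[/andP[/and3P[_ SX /eqP rS] _] SM].
  by apply: incl_rk_eq; rewrite ?incl_meet ?SX // rXM rS.
move=> ->; rewrite /between /= incl_meet TX TM meet_incll meet_inclr rXM eqxx andbT /=.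
apply: contraFN XHM => XMH; have <- : meet X M = meet X H.
  by apply: incl_rk_eq; rewrite ?rXM ?rXH // incl_meet meet_incll.
exact: meet_inclr.
Qed.

Lemma consistent_off_hyper_weight M k t a : hyperplane M A -> M != H ->
  consistent A k t a ->
  consistent (meet M H) k.-1 t.-1 (off_sum (hyper_weight M) a).
Proof.
move=> hM neMH ca; apply: consistent_off_sum ca (meet_inclr M H) _ => T X.
exact: sum_off_hyper_weight.
Qed.

(** Compare the coefficients of each [a J], up to the factor [q ^ rk T]. With [r = rk H - rk T],
    that of [a I] is [1 + q [r] - [r] = q ^ r]. For [J != I] the join of [I] and [J] has rank
    [rk T + 2], which gives [1 + q [r - 1] - [r] = 0]. *)
Lemma off_sum_inversion a I : incl I A -> ~~ incl I H -> (rk I <= rk H)%N ->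
  off_sum (fun=> 1) a (meet I H)
  + \sum_(M | [&& incl I M, incl M A & (rk M).+1 == rk A])
      off_sum (hyper_weight M) a (meet I H)
  = (q ^ rk H)%:R * a I.
Proof.
move=> IA nI rIH; set T := meet I H.
have rI : rk I = (rk T).+1 := rk_meet_hyperplane hH IA nI.
have TH : incl T H := meet_inclr I H.
have rA : rk A = (rk H).+1 by case: hH.
rewrite /off_sum -mulr_sumr -mulrDr exchange_big -big_split /=.
rewrite -(subnKC (rk_incl TH)) expnD natrM -mulrA; congr (_ * _).
rewrite (bigD1 I) /=; last by rewrite /between /= meet_incll IA rI eqxx.
have sumw J : incl J A ->
  \sum_(M | [&& incl I M, incl M A & (rk M).+1 == rk A]) hyper_weight M J
   = q%:R * (qnum q (rk A - rk (join I J)))%:R - (qnum q (rk A - rk I))%:R.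
  move=> JA; rewrite sumrB -!card_coatoms ?incl_join ?IA ?JA // -mulr_sumr -!sum1_card.
  rewrite sum_indicator !natr_sum; congr (_ * _ - _); apply: eq_bigl => M.
  by rewrite !inE incl_join andbAC.
rewrite -mulr_sumr sumw // big1 ?addr0; last first.
  move=> J /andP[/andP[bJ nJ] JI].
  have JH := off_cover_meet TH bJ nJ.
  have /and3P[TJ JA /eqP rJ] := bJ.
  rewrite -mulr_sumr sumw //.
  have rJI : rk (meet I J) = rk T.
    apply/eqP; rewrite eqn_leq [X in _ && X]rk_incl ?incl_meet ?meet_incll ?TJ // andbT.
    rewrite leqNgt; apply: contra JI => lt; have -> : J = meet I J.
      by apply/esym/incl_rk_eq; rewrite ?meet_inclr ?rJ.
    by apply/eqP/incl_rk_eq; rewrite ?meet_incll ?rI.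
  have := rk_modular I J; rewrite rJI rI rJ => rU.
  have -> : rk (join I J) = (rk T).+2 by lia.
  have -> : (rk A - (rk T).+1 = (rk A - (rk T).+2).+1)%N by rewrite rA; lia.
  by rewrite qnumS natrD natrM; ring.
have -> : join I I = I.
  by apply: incl_anti; rewrite ?incl_joinl // incl_join !incl_refl.
rewrite rI rA subSS; set r := (_ - _)%N.
have e : (1 + q * qnum q r = qnum q r + q ^ r)%N by rewrite -qnumS qnumSr.
have {}e : 1 + q%:R * (qnum q r)%:R = (qnum q r)%:R + (q ^ r)%:R :> int.
  by rewrite -natrM -!natrD -e natrD.
have -> : (q ^ r)%:R = 1 + q%:R * (qnum q r)%:R - (qnum q r)%:R :> int.
  by rewrite e addrC addKr.
ring.
Qed.

End Hyperplane.

Lemma hyperplane_meet2 M H A : hyperplane M A -> hyperplane H A -> M != H ->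
  hyperplane (meet M H) M.
Proof.
move=> [MA rM] hH neMH; apply: (hyperplane_meet hH MA).
have [_ rH] := hH; apply: contra neMH => MH; apply/eqP/incl_rk_eq => //.
by move: rM; rewrite rH => -[->].
Qed.

Lemma solve_off N1 N2 k t H A a : solvable N1 (rk A).-1 k t ->
  solvable N2 (rk A).-2 k t -> hyperplane H A -> (t < rk H)%N ->
  consistent A k.+1 t.+1 a ->
  exists g, forall I, incl I A -> ~~ incl I H -> (rk I <= t.+1)%N ->
    shadow A k.+1 g I = (q ^ (N1 + N2 + rk H))%:R * a I.
Proof.
move=> s1 s2 hH tH ca; have [HA rA] := hH.
have [|g1 Dg1] := s1 H _ _ (consistent_off_sum1 hH ca); first by rewrite rA.
(* One solution is chosen for every [M] at once; the zero function serves where [M] is [H] or no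
   hyperplane of [A]. *)
have [|gM DgM] := @fin_all_exists _ (fun=> subspace V -> int) (fun M g =>
  hyperplane M A -> M != H -> forall I, incl I (meet M H) -> (rk I <= t)%N ->
    shadow (meet M H) k g I = (q ^ N2)%:R * off_sum H A (hyper_weight M) a I).
  move=> M; have [/andP[MA /eqP rM]|nM] := boolP (incl M A && ((rk M).+1 == rk A)); last first.
    exists (fun=> 0) => -[MA rM] _; case/negP: nM; rewrite MA rM /=.
    by apply/eqP.
  have [->|neMH] := eqVneq M H; first by exists (fun=> 0).
  have hM : hyperplane M A by split.
  have [|g Dg] := s2 (meet M H) _ _ (consistent_off_hyper_weight hH hM neMH ca).
    by have [_] := hyperplane_meet2 hM hH neMH; rewrite -rM => ->.
  by exists g.
(* The cross factors bring both parts to [q ^ (N1 + N2)]; [off_sum_inversion] supplies the remaining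
   [q ^ rk H]. *)
exists (fun K => (q ^ N2)%:R * g1 (meet K H) + (q ^ N1)%:R *
   \sum_(M | [&& incl K M, incl M A & (rk M).+1 == rk A]) gM M (meet K H)) => I IA nI rI.
have rT := rk_meet_hyperplane hH IA nI.
rewrite (@shadowD _ _ (fun K => g1 (meet K H))) {1}/shadow.
rewrite (big_between_meet _ k _ hH IA nI) -/(shadow H k g1 _) Dg1 ?meet_inclr //; last by lia.
rewrite !expnD !natrM -mulrA -(off_sum_inversion hH) //; last by lia.
rewrite mulrDr mulrA [(q ^ N2)%:R * _]mulrC -!mulrA; congr (_ + _ * _).
rewrite mulr_sumr /shadow.
rewrite (exchange_big_dep (fun M => [&& incl I M, incl M A & (rk M).+1 == rk A])) /=;
  last first.
  move=> K M /and3P[IK KA _] /and3P[KM MA rM].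
  by rewrite MA rM (incl_trans IK KM).
apply: eq_bigr => M /and3P[IM MA /eqP rM].
have neMH : M != H by apply: contra nI => /eqP <-.
have hM : hyperplane M A by split.
have hMH := hyperplane_meet2 hM hH neMH.
have nIM : ~~ incl I (meet M H) by rewrite incl_meet negb_and nI orbT.
(* For fixed [M] the [K] run between [I] and [M], so the bijection is applied to the hyperplane
   [meet M H] of [M]. *)
have meetMH K : incl K M -> meet K (meet M H) = meet K H.
  move=> KM; apply: incl_anti; rewrite incl_meet meet_incll /=.
    by apply: incl_trans (meet_inclr _ _) (meet_inclr _ _).
  by rewrite meet_incl2.
rewrite -DgM // ?meet_incl2 //; last by lia.
rewrite -(meetMH I) // /shadow -(big_between_meet _ k _ hMH IM nIM).
transitivity (\sum_(K in between I M k.+1) gM M (meet K H)).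
  apply: eq_bigl => K; rewrite !inE MA rM eqxx !andbT /=.
  case KM: (incl K M); rewrite ?andbF ?andbT //=.
  by rewrite (incl_trans KM MA).
by apply: eq_bigr => K /and3P[_ KM _]; rewrite meetMH.
Qed.

End Designs.

(** * Solvability by induction on the rank *)

Section Solvability.
Variable V : ambient.
Implicit Types A H I K L M S X Y Z T D : subspace V.
Implicit Types a g w : subspace V -> int.
Notation q := (order_of V).

(** In the relation at [S] below [H], the covers of [S] off [H] contribute zero. *)
Lemma consistent_restrict H A k t a : incl H A -> consistent A k t a ->
  (forall I, incl I A -> ~~ incl I H -> (rk I <= t)%N -> a I = 0) ->
  consistent H k t a.
Proof.
move=> HA ca a0 S SH rS; rewrite (ca _ (incl_trans SH HA) rS) /shadow.
rewrite (bigID [pred X | incl X H]) /= addrC big1 ?add0r => [|X].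
  apply: eq_bigl => X; rewrite !inE.
  by case XH: (incl X H); rewrite ?andbF //= (incl_trans XH HA) andbT.
by move=> /andP[/and3P[_ XA /eqP rX] nX]; apply: a0; rewrite ?rX.
Qed.

Lemma shadow_restrict H A k g I : incl H A ->
  shadow A k (fun K => (incl K H)%:R * g K) I = shadow H k g I.
Proof.
move=> HA; rewrite /shadow big_mkcond [RHS]big_mkcond; apply: eq_bigr => K _.
rewrite !inE; case KH: (incl K H); last by rewrite mul0r andbF if_same.
by rewrite (incl_trans KH HA) mul1r.
Qed.

Lemma shadow_off H k g I : ~~ incl I H -> shadow H k g I = 0.
Proof.
move=> nI; apply: big_pred0 => K; rewrite !inE.
by apply/and3P => -[IK KH _]; case/negP: nI; apply: incl_trans KH.
Qed.

Definition hyper_lift H g K : int := (~~ incl K H)%:R * g (meet K H).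

Lemma shadow_hyper_lift_off H A k g I : hyperplane H A -> incl I A -> ~~ incl I H ->
  shadow A k.+1 (hyper_lift H g) I = shadow H k g (meet I H).
Proof.
move=> hH IA nI; rewrite /shadow -(big_between_meet _ k _ hH IA nI).
apply: eq_bigr => K /and3P[IK _ _]; rewrite /hyper_lift.
by rewrite (contra (incl_trans IK) nI) mul1r.
Qed.

(** Each [D] of rank [k] in [H] equals [meet K H] for [q ^ (rk H - k)] subspaces [K] off [H], namely
    its covers off [H]. *)
Lemma shadow_hyper_lift H A k g I : hyperplane H A -> incl I H ->
  shadow A k.+1 (hyper_lift H g) I = (q ^ (rk H - k))%:R * shadow H k g I.
Proof.
move=> hH IH; have [HA rA] := hH; rewrite /shadow mulr_sumr /hyper_lift.
transitivity (\sum_(K | between I A k.+1 K && ~~ incl K H) g (meet K H)).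
  rewrite [RHS]big_mkcondr; apply: eq_bigr => K _.
  by case: ifP => _; rewrite ?mul1r ?mul0r.
rewrite (partition_big (fun K => meet K H) [in between I H k]) /=; last first.
  move=> K /andP[/and3P[IK KA /eqP rK] nK].
  rewrite !inE incl_meet IK IH meet_inclr /=.
  by have := rk_meet_hyperplane hH KA nK; rewrite rK => -[->].
apply: eq_bigr => D /and3P[ID DH /eqP rD].
rewrite (eq_bigr (fun=> g D)) => [|K /andP[_ /eqP->] //].
rewrite sumr_const -rD -(card_covers_off hH DH) mulr_natl; congr (_ *+ _).
apply: eq_card => K; rewrite !inE [LHS]unfold_in /between /= -andbA; apply/idP/idP.
  move=> /and3P[/and3P[IK KA rK] nK /eqP DK].
  by rewrite -{1}DK meet_incll KA nK rK.
move=> /andP[/and3P[DK KA rK] nK]; rewrite (incl_trans ID DK) KA rK nK /=.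
apply/eqP/esym/incl_rk_eq; first by rewrite incl_meet DK.
by have := rk_meet_hyperplane hH KA nK; rewrite (eqP rK) => -[->].
Qed.

Lemma solvable_step N1 N2 N3 n k t : (t <= k)%N -> (k + t.+1 < n)%N ->
  solvable V N1 n k t -> solvable V N2 n.-1 k t -> solvable V N3 n k.+1 t.+1 ->
  solvable V (N3 + (N1 + N2 + n)) n.+1 k.+1 t.+1.
Proof.
move=> tk ktn s1 s2 s3 A a rA ca.
have [|H /and3P[_ HA /eqP rH]] := @ex_between V (bottom V) A n (bottom_incl A).
  by rewrite rk_bottom rA leqnSn.
have hH : hyperplane H A by split; rewrite ?rH.
have [|||g1 Dg1] := @solve_off V N1 N2 k t H A a _ _ hH _ ca; rewrite ?rA ?rH //; first by lia.
(* The residue vanishes off [H], hence is consistent on [H]; its solution there is extended by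
   zero. *)
pose a' I := (q ^ (N1 + N2 + n))%:R * a I + -1 * shadow A k.+1 g1 I.
have ca' : consistent H k.+1 t.+1 a'.
  apply: (consistent_restrict HA).
    by apply: consistentD ca _; apply: consistent_shadow.
  by move=> I IA nI rI; rewrite /a' Dg1 // rH mulN1r subrr.
have [g0 Dg0] := s3 H a' rH ca'.
exists (fun K => (q ^ N3)%:R * g1 K + 1 * ((incl K H)%:R * g0 K)) => I IA rI.
rewrite (shadowD _ _ g1) (shadow_restrict _ _ _ HA).
have [IH|nI] := boolP (incl I H).
  by rewrite Dg0 // /a' (expnD _ N3) natrM; ring.
by rewrite (shadow_off _ _ nI) Dg1 // rH (expnD _ N3) natrM; ring.
Qed.

(* If [k.+1 + t.+1 = n.+1], the remaining system on [H], of rank [n], is outside the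
   range of the induction hypothesis; it is solved there up to rank [t] only, and the top-rank error is corrected by [hyper_lift], which
   adds nothing off [H] because the error vanishes in lower ranks. *)
Lemma solvable_edge N1 N2 N3 N4 n k t : (t < k)%N -> (t < n)%N ->
  solvable V N1 n k t -> solvable V N2 n.-1 k t ->
  solvable V N3 n k.+1 t -> solvable V N4 n k t.+1 ->
  solvable V (N4 + (n - k) + N3 + (N1 + N2 + n)) n.+1 k.+1 t.+1.
Proof.
move=> tk tn s1 s2 s3 s4 A a rA ca.
have [|H /and3P[_ HA /eqP rH]] := @ex_between V (bottom V) A n (bottom_incl A).
  by rewrite rk_bottom rA leqnSn.
have hH : hyperplane H A by split; rewrite ?rH.
have [|||g1 Dg1] := @solve_off V N1 N2 k t H A a _ _ hH _ ca; rewrite ?rA ?rH //.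
pose a' I := (q ^ (N1 + N2 + n))%:R * a I + -1 * shadow A k.+1 g1 I.
have ca' : consistent H k.+1 t.+1 a'.
  apply: (consistent_restrict HA).
    by apply: consistentD ca _; apply: consistent_shadow.
  by move=> I IA nI rI; rewrite /a' Dg1 // rH mulN1r subrr.
have [|g0 Dg0] := s3 H a' rH.
  by move=> S SH rS; apply: ca' => //; apply: leqW.
pose b I := (q ^ N3)%:R * a' I + -1 * shadow H k.+1 g0 I.
have b0 I : incl I H -> (rk I <= t)%N -> b I = 0.
  by move=> IH rI; rewrite /b Dg0 // mulN1r subrr.
have cb : consistent H k.+1 t.+1 b.
  by apply: consistentD ca' _; apply: consistent_shadow.
(* Since [b] is zero up to rank [t], both sides of each relation vanish, so [k] may replace
   [k.+1]. *)
have [|g2 Dg2] := s4 H b rH.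
  by move=> S SH rS; rewrite b0 // mulr0 -(cb S SH rS) b0 ?mulr0.
(* Below [H] the lift of [g2] yields [b] with this factor: [q ^ N4] from [g2] and [q ^ (n - k)] from
   [hyper_lift]. *)
pose c : int := (q ^ (N4 + (n - k)))%:R.
exists (fun K => 1 * ((c * (q ^ N3)%:R) * g1 K + c * ((incl K H)%:R * g0 K))
                 + 1 * hyper_lift H g2 K) => I IA rI.
rewrite (shadowD _ _ _ (hyper_lift H g2)) (shadowD _ _ g1) (shadow_restrict _ _ _ HA).
have [IH|nI] := boolP (incl I H).
  rewrite (shadow_hyper_lift _ _ hH) // rH Dg2 // /b /a' /c !expnD !natrM; ring.
rewrite (shadow_off _ _ nI) (shadow_hyper_lift_off _ _ hH) // Dg2 ?meet_inclr //; last first.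
  by apply: leq_trans rI; rewrite rk_incl ?meet_incll.
rewrite b0 ?meet_inclr //; last by have := rk_meet_hyperplane hH IA nI; lia.
by rewrite Dg1 // rH /c !expnD !natrM; ring.
Qed.

Lemma solvable_exists n k t : (t <= k)%N -> (k + t <= n)%N ->
  exists N, solvable V N n k t.
Proof.
elim/ltn_ind: n k t => n IHn k [|t] tk ktn.
  by exists 0%N; apply: solvable0; lia.
have [->|ltk] := eqVneq t.+1 k; first by exists 0%N; apply: solvable_diag.
case: k => // k in tk ktn ltk *; case: n => [|n] in IHn ktn *; first by lia.
have {ltk} ltk : (t < k)%N by move: ltk; lia.
have [||| N1 s1] := IHn n _ k t; try lia.
have [||| N2 s2] := IHn n.-1 _ k t; try lia.
(* The pair [k.+1], [t.+1] is in range for rank [n] exactly in the first case. *)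
have [lt|le] := ltnP (k.+1 + t) n.
  have [||| N3 s3] := IHn n _ k.+1 t.+1; try lia.
  by eexists; apply: solvable_step s1 s2 s3; lia.
have [||| N3 s3] := IHn n _ k.+1 t; try lia.
have [||| N4 s4] := IHn n _ k t.+1; try lia.
by eexists; apply: solvable_edge s1 s2 s3 s4; lia.
Qed.

End Solvability.

(** * Gaussian binomials as counts, and the divisibility *)

Lemma gauss_binom_card (V : ambient) (S A : subspace V) (j : nat) : incl S A ->
  gauss_binom (order_of V) (rk A - rk S) j = #|between S A (rk S + j)|.
Proof.
move=> SA; have := card_between j SA; set q := order_of V; set r := (rk A - rk S)%N.
have q_gt0 : (0 < q)%N := @order_of_gt0 V.
rewrite /gauss_binom; case: eqP => [->|/eqP q1].
  have qnum1n i : qnum 1 i = i.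
    by elim: i => [|i IHi]; rewrite ?qnum0 // qnumS IHi mul1n.
  under eq_bigr do rewrite qnum1n; under [RHS]eq_bigr do rewrite qnum1n.
  rewrite -ffact_prod -bin_ffact fact_prod big_add1 big_mkord => /eqP.
  rewrite eqn_pmul2r => [/eqP-> //|]; exact: prodn_gt0.
(* Every factor [q ^ i - 1] is a q-number times [q - 1]; these powers of [q - 1] cancel and
   [card_between] makes the division exact. *)
move=> e; pose c := (\prod_(i < j) (q - 1))%N.
have qq i : (q ^ i - 1 = qnum q i * (q - 1))%N by rewrite qnum_geom.
under eq_bigr do rewrite qq; under [X in (_ %/ X)%N]eq_bigr do rewrite qq.
rewrite !big_split /= -e -mulnA mulnK // muln_gt0.
by rewrite !prodn_gt0 // => i; rewrite ?qnum_gt0 //; lia.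
Qed.

(** By [card_between] the count divides a product of q-numbers of positive index, each congruent to
    1 modulo [q]. *)
Lemma coprime_card_between (V : ambient) (S A : subspace V) (j : nat) :
  incl S A -> (rk S + j <= rk A)%N ->
  coprime (order_of V) #|between S A (rk S + j)|.
Proof.
move=> SA jA; have : coprime (order_of V) (\prod_(i < j) qnum (order_of V) (rk A - rk S - i)).
  apply: (big_ind (coprime (order_of V))) => [|x y cx cy|i _].
  - exact: coprimen1.
  - by rewrite coprimeMr cx.
  - by apply: coprime_qnum; have := ltn_ord i; lia.
by rewrite -card_between // coprimeMr => /andP[].
Qed.

Lemma sum_Gr (R : nmodType) (V : ambient) (k : nat) (F : subspace V -> R) :
  \sum_(K : Gr V k) F (val K) = \sum_(K | rk K == k) F K.
Proof.
rewrite [RHS](reindex_omap (val : Gr V k -> subspace V) insub) => [|K rK]; last first.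
  by rewrite insubT.
by apply: eq_bigl => K; rewrite valK eqxx andbT (valP K).
Qed.

(** By linearity it suffices to pair [u] with a generator [char_fun R k U], which gives the sum of
    [u] above [U]. *)
Lemma Vbar_orthogonal (R : realType) (V : ambient) (k t : nat)
    (u : subspace V -> R) (f : {ffun Gr V k -> R^o}) :
  (forall I, rk I = t -> \sum_(K in between I (whole V) k) u K = 0) ->
  f \in Vbar R V k t -> \sum_(K : Gr V k) f K * u (val K) = 0.
Proof.
move=> u0 /(@coord_span _ _ _ (in_tuple _)) ->.
under eq_bigr do rewrite sum_ffunE mulr_suml; rewrite exchange_big big1 //= => i _.
set X := [seq _ | _ in _]; have /mapP[U _ ->] : X`_i \in X by rewrite mem_nth.
under eq_bigr do rewrite !ffunE -[_ *: _]/(_ * _) -mulrA; rewrite -mulr_sumr.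
rewrite (sum_Gr k (fun K => (incl (val U) K)%:R * u K)).
rewrite [X in _ * X](_ : _ = 0) ?mulr0 //; rewrite -[RHS](u0 (val U) (eqP (valP U))).
rewrite big_mkcond [RHS]big_mkcond; apply: eq_bigr => K _.
rewrite !inE incl_whole /= andbC; case: eqP => //= _.
by case: (incl _ _); rewrite ?mul1r ?mul0r.
Qed.

Theorem theorem4p7 (R : realType) (V : ambient) (k t : nat)
    (hk : (k <= ambient_rk V)%N)
    (f : {ffun Gr V k -> int}) (hf : f <> 0)
    (hdeg : has_degree (int_to_real_fun R f) t) :
  ((\big[gcdn/0%N]_(0 <= i < t.+1)
      gauss_binom (order_of V) (ambient_rk V - i) (k - i))%:Z
    %| fun_size f)%Z.
Proof.
case: hdeg; rewrite leq_min => /andP[tk tn] fV _.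
set q := order_of V; set d := \big[_/_]_(_ <= _ < _) _.
pose W := whole V; pose c (I : subspace V) := #|between I W k|.
have d_dvd I : (rk I <= t)%N -> (d %| c I)%N.
  move=> rI; rewrite /d big_mkord.
  (* The term of the gcd with index [rk I] is [c I]. *)
  apply: (@biggcdn_inf _ (Ordinal (rI : rk I < t.+1)%N)) => //=.
  rewrite gauss_binom_card ?incl_whole // subnKC //; exact: leq_trans tk.
have rW : rk W = ambient_rk V by [].
have q_c : coprime q (c (bottom V)).
  by rewrite /c -(add0n k) -(rk_bottom V) coprime_card_between ?bottom_incl // rk_bottom rW.
have d_bot : (d %| c (bottom V))%N by apply: d_dvd; rewrite rk_bottom.
have q_d : coprime q d := coprime_dvdr d_bot q_c.
have d_gt0 : (0 < d)%N.
  apply: dvdn_gt0 d_bot; have [K Kb] : exists K, between (bottom V) W k K.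
    by apply: ex_between (bottom_incl _) _; rewrite rk_bottom rW.
  by apply/card_gt0P; exists K.
have d0 : d%:R != 0 :> int by rewrite pnatr_eq0 -lt0n.
(* Up to rank [t] the division is exact, so [d] times [a] is the shadow of the constant 1 and
   consistency follows on cancelling [d]. *)
pose a (I : subspace V) : int := (c I %/ d)%:R.
have da I : (rk I <= t)%N -> d%:R * a I = shadow W k (fun=> 1) I.
  by move=> rI; rewrite -natrM mulnC divnK ?d_dvd // /shadow sumr_const.
have ca : consistent W k t a.
  move=> S SW rS; apply: (mulfI d0); rewrite mulrCA da; last exact: ltnW.
  rewrite -shadow_shadow // /shadow mulr_sumr.
  by apply: eq_bigr => K /and3P[_ _ /eqP rK]; rewrite da ?rK.
have [|N s] := @solvable_exists V (rk W) k t tk; first by rewrite rW; lia.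
have [g Dg] := s W a erefl ca.
(* The sum of [u] above any [I] of rank [t] is [d * q ^ N * a I - q ^ N * c I = 0]. *)
pose u (K : subspace V) : int := d%:R * g K - (q ^ N)%:R.
have : \sum_(K : Gr V k) int_to_real_fun R f K * (u (val K))%:~R = 0.
  apply: (Vbar_orthogonal (u := fun K => (u K)%:~R)) fV => I rI.
  rewrite -rmorph_sum /= sumrB -mulr_sumr -[\sum_(_ in _) g _]/(shadow W k g I).
  rewrite Dg ?incl_whole ?rI // mulrCA da ?rI // /shadow mulr_sumr.
  under [X in X - _]eq_bigr do rewrite mulr1.
  by rewrite subrr.
under eq_bigr do rewrite ffunE -intrM; rewrite -rmorph_sum /= => /eqP.
rewrite intr_eq0 => /eqP.
under eq_bigr do rewrite mulrBr [f _ * _]mulrCA; rewrite sumrB -mulr_sumr -mulr_suml.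
move=> /subr0_eq e; rewrite -(@Gauss_dvdzl _ _ (q ^ N)%:Z).
  by rewrite /fun_size -[(q ^ N)%:Z]natz -e -natz dvdz_mulr.
by rewrite coprimezE !absz_nat coprime_sym coprimeXl.
Qed.
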